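(* Let $r>1$ be an odd integer. For a group $G$ of order $r$ that is nilpotent of class at most $2$, let $F_0(G),F_1(G),\ldots,F_T(G)$ denote the string of $G$ (defined in the context), where $T=\sum_{j=1}^{s}t_j$. Then: (a) For every group $G$ of order $r$ that is nilpotent of class at most $2$, no two terms of the string of $G$ are isomorphic; that is, $F_i(G)\not\cong F_{i'}(G)$ for all $0\le i<i'\le T$. (b) For every such $G$, the last term $F_T(G)$ of the string of $G$ is an abelian group. (c) If $G$ and $H$ are groups of order $r$, both nilpotent of class at most $2$, and $G$ and $H$ have the same order structure, then the last term of the string of $G$ and the last term of the string of $H$ are the same up to isomorphism.
   Context: Write $[x,y]=x^{-1}y^{-1}xy$. Groups that are nilpotent of class at most $2$ are those whose commutator subgroup is contained in the center (abelian groups are included). The groups $S_n^i(G)$: given a group $(G,\cdot)$ that is nilpotent of class at most $2$ and a positive integer $n$, let $S_n(G)$ be the set $G$ with the binary operation $x\circ^n y:=[x,y]^n xy$, where the commutator and the products on the right are computed in $(G,\cdot)$. Then $(S_n(G),\circ^n)$ is again a group that is nilpotent of class at most $2$. Define inductively $S_n^0(G)=G$ and $S_n^{i+1}(G)=S_n(S_n^i(G))$ for $i\ge 0$. Order structure: for a group $G$ of order $r$, the order structure of $G$ is the $r$-tuple $(n_1,\ldots,n_r)$ of natural numbers with $1=n_1\le n_2\le\cdots\le n_r$ such that the elements of $G$ can be listed as $x_1,\ldots,x_r$ with the order of $x_i$ equal to $n_i$ for each $i$ (i.e. the nondecreasing list of the orders of all elements of $G$). The string of $G$: let $r=p_1^{r_1}p_2^{r_2}\cdots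 p_s^{r_s}$ with odd primes $p_1<p_2<\cdots<p_s$ and $r_j>0$. Let $G$ be a group of order $r$ that is nilpotent of class at most $2$, so $G=P_1P_2\cdots P_s$ is the (internal direct) product of its Sylow $p_j$-subgroups $P_j$. Put $n_j=\frac{p_j-1}{2}$, and let $p_j^{t_j}$ ($t_j\ge 0$) be the exponent of the commutator subgroup of $P_j$. Put $T_0=0$, $T_m=t_1+\cdots+t_m$ for $1\le m\le s$, and $T=T_s$. The string of $G$ is the sequence of groups $F_0(G),\ldots,F_T(G)$ of length $T+1$, each defined up to isomorphism, given by $F_0(G)\cong G$ and, for $1\le m\le s$ and $T_{m-1}<i\le T_m$, $$F_i(G)\cong S_{n_1}^{t_1}(P_1)\times\cdots\times S_{n_{m-1}}^{t_{m-1}}(P_{m-1})\times S_{n_m}^{\,i-T_{m-1}}(P_m)\times P_{m+1}\times\cdots\times P_s .$$ Each $F_i(G)$ has order $r$ and is nilpotent of class at most $2$. *)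

(* Defs.v *)
From HB Require Import structures.
From mathcomp Require Import all_boot all_fingroup all_solvable.

Set Implicit Arguments.
Unset Strict Implicit.
Unset Printing Implicit Defensive.

Local Open Scope group_scope.

(* Finite groups that are nilpotent of class at most 2, abelian groups
   included: G' is contained in Z(G). *)
HB.mixin Record FinGroup_isNil2 G of FinGroup G := {
  der1_sub_center : [set: G]^`(1) \subset 'Z([set: G])
}.

#[short(type="nil2GroupType")]
HB.structure Definition Nil2Group := {G of FinGroup_isNil2 G & FinGroup G}.

Lemma der1_sub_centerP (G : finGroupType) :
  (forall x y z : G, commute [~ x, y] z) ->
  [set: G]^`(1) \subset 'Z([set: G]).
Proof.
move=> cG; rewrite /= gen_subG; apply/subsetP=> _ /imset2P[x y _ _ ->].
by rewrite inE in_setT; apply/centP=> z _; apply: cG.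
Qed.

Lemma commg_central (G : nil2GroupType) (x y z : G) : commute [~ x, y] z.
Proof.
have /subsetP sub := der1_sub_center (s := G).
have /setIP[_ /centP c] : [~ x, y] \in 'Z([set: G]).
  by apply: sub; rewrite mem_commg ?inE.
exact: (c z (in_setT z)).
Qed.

(* The carrier of S_n(G) is that of G. The argument n is a phantom on which the
   inference of the group structure depends. *)
Definition twist (n : nat) (G : nil2GroupType) : Type := G.

Section Twist.

Variables (n : nat) (G : nil2GroupType).

HB.instance Definition _ := Finite.on (twist n G).

Definition twist_mul (x y : G) : G := [~ x, y] ^+ n * x * y.

Implicit Types x y z : G.

Let central (x : G) := forall z, commute x z.

Local Lemma centralX x k : central x -> central (x ^+ k).
Proof. by move=> cx z; apply/commute_sym/commuteX/commute_sym/cx. Qed.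

Local Lemma centralM x y : central x -> central y -> central (x * y).
Proof. by move=> cx cy z; apply/commute_sym/commuteM; apply/commute_sym. Qed.

Local Lemma central_comm x y : central [~ x, y].
Proof. by move=> z; apply: commg_central. Qed.

Local Lemma central1l x y : central x -> [~ x, y] = 1.
Proof. by move=> cx; apply/eqP/commgP/cx. Qed.

Local Lemma central1r x y : central x -> [~ y, x] = 1.
Proof. by move=> cx; apply/eqP/commgP/commute_sym/cx. Qed.

Local Lemma commMl x y z : [~ x * y, z] = [~ x, z] * [~ y, z].
Proof. by rewrite commMgR (central1l y (central_comm x z)) mulg1. Qed.

Local Lemma commMr x y z : [~ x, y * z] = [~ x, y] * [~ x, z].
Proof.
rewrite commgMR (central1l z (central_comm x y)) mulg1.
exact: central_comm.
Qed.

Local Lemma central_commX x y k : central ([~ x, y] ^+ k).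
Proof. exact/centralX/central_comm. Qed.

Local Lemma expcM x y u v :
  ([~ x, y] * [~ u, v]) ^+ n = [~ x, y] ^+ n * [~ u, v] ^+ n.
Proof. exact/expgMn/central_comm. Qed.

Fact twist_mulA : associative twist_mul.
Proof.
move=> x y z; rewrite /twist_mul !commMr !commMl.
rewrite (central1l z (@central_commX x y n)).
rewrite (central1r x (@central_commX y z n)) !mul1g !expcM.
set a := [~ x, y] ^+ n; set b := [~ x, z] ^+ n; set c := [~ y, z] ^+ n.
have ca : central a by apply: central_commX.
have cc : central c by apply: central_commX.
rewrite !mulgA; congr (_ * _ * _).
have -> : b * c * a = a * b * c by rewrite -(ca (b * c)) mulgA.
by rewrite -!mulgA (cc x).
Qed.

Local Lemma central_twist_comm x y :
  central (twist_mul x^-1 (twist_mul y^-1 (twist_mul x y))).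
Proof.
rewrite [twist_mul y^-1 _]/twist_mul [twist_mul x y]/twist_mul.
rewrite /twist_mul -mulgA; apply: centralM; first exact: central_commX.
set k := [~ y^-1, _] ^+ n; set l := [~ x, y] ^+ n.
have ck : central k by apply: central_commX.
have cl : central l by apply: central_commX.
have -> : x^-1 * (k * y^-1 * (l * x * y)) = k * l * [~ x, y].
  have e : x^-1 * (k * y^-1 * (l * x * y)) = (x^-1 * k) * (y^-1 * l * x * y).
    by rewrite !mulgA.
  rewrite e -(ck x^-1) -(cl y^-1) commgEl conjgE !mulgA.
  by rewrite -[k * l * _]mulgA (cl x^-1) !mulgA.
by apply: centralM; [apply: centralM | apply: central_comm].
Qed.

Fact twist_mul1 : left_id 1 twist_mul.
Proof. by move=> x; rewrite /twist_mul comm1g expg1n !mul1g. Qed.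

Fact twist_mulV : left_inverse 1 (fun x : G => x^-1) twist_mul.
Proof.
move=> x; rewrite /twist_mul (_ : [~ x^-1, x] = 1) ?expg1n ?mul1g ?mulVg //.
by apply/eqP/commgP/commute_sym/commuteV.
Qed.

HB.instance Definition _ :=
  Finite_isGroup.Build (twist n G) twist_mulA twist_mul1 twist_mulV.

Fact twist_der1_sub_center : [set: twist n G]^`(1) \subset 'Z([set: twist n G]).
Proof.
apply: der1_sub_centerP => x y z.
have com_tw (u v : twist n G) : central u -> commute u v.
  move=> cu; change (twist_mul u v = twist_mul v u).
  by rewrite /twist_mul central1l // central1r // expg1n !mul1g; apply: cu.
apply: com_tw.
exact: (@central_twist_comm x y).
Qed.

HB.instance Definition _ :=
  FinGroup_isNil2.Build (twist n G) twist_der1_sub_center.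

End Twist.

Lemma twistM (n : nat) (G : nil2GroupType) (x y : G) :
  (x : twist n G) * (y : twist n G) = ([~ x, y] ^+ n * x * y : G).
Proof. by []. Qed.

Definition iter_twist (n i : nat) (G : nil2GroupType) : nil2GroupType :=
  iter i (fun K : nil2GroupType => twist n K : nil2GroupType) G.

Section Subgroup.

Variables (G : nil2GroupType) (P : {group G}).

Fact subg_der1_sub_center : [set: subg_of P]^`(1) \subset 'Z([set: subg_of P]).
Proof.
by apply: der1_sub_centerP => x y z; apply/val_inj; apply: commg_central.
Qed.

HB.instance Definition _ :=
  FinGroup_isNil2.Build (subg_of P) subg_der1_sub_center.

End Subgroup.

Section String.

Variable G : nil2GroupType.

(* Indices are shifted by one: the primes are p_0 < p_1 < ... < p_(s-1). *)
Definition nprimes : nat := size (primes #|G|).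

Definition prime_at (j : nat) : nat := nth 1%N (primes #|G|) j.

(* G is nilpotent, so its p-core is its unique Sylow p-subgroup. *)
Definition Sylow_at (j : nat) : {group G} := 'O_(prime_at j)([set: G])%G.

Lemma Sylow_at_Sylow j : (prime_at j).-Sylow([set: G]) (Sylow_at j).
Proof.
apply: nilpotent_pcore_Hall.
apply/lcnP; exists 2; apply/commG1P.
exact: subset_trans (der1_sub_center (s := G)) (subsetIr _ _).
Qed.

Definition texp (j : nat) : nat :=
  logn (prime_at j) (exponent (Sylow_at j)^`(1)).

Lemma texpE j : j < nprimes ->
  exponent (Sylow_at j)^`(1) = (prime_at j ^ texp j)%N.
Proof.
move=> ltj; rewrite /texp -p_part part_pnat_id // pnat_exponent.
apply: pgroupS (der_sub 1 _) _; exact: pHall_pgroup (Sylow_at_Sylow j).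
Qed.

Definition Tsum (m : nat) : nat := \sum_(0 <= j < m) texp j.

Definition string_last : nat := Tsum nprimes.

(* Number of times that S_(n_j) is applied to P_j in F_i(G). With truncated
   subtraction this is 0 if i <= Tsum j, is i - Tsum j if
   Tsum j < i <= Tsum j.+1, and is texp j if Tsum j.+1 < i. *)
Definition string_steps (i j : nat) : nat := minn (i - Tsum j) (texp j).

Definition string_factor (i : nat) (j : 'I_nprimes) : nil2GroupType :=
  iter_twist (prime_at j).-1./2 (string_steps i j) (subg_of (Sylow_at j)).

Definition group_string (i : nat) : finGroupType :=
  if i is 0 then (G : finGroupType)
  else {dffun forall j : 'I_nprimes, string_factor i j} : finGroupType.

End String.

Definition order_structure (G : finGroupType) : seq nat :=
  sort leq [seq #[x] | x : G].

(* Main.v *)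
Require Import Defs.
From mathcomp Require Import all_boot all_fingroup all_solvable.

(** Twisting by n leaves the powers of an element unchanged and raises every
    commutator to the power 2n + 1. For n = (p - 1) / 2 each twist of a p-group
    therefore divides the exponent of the commutator subgroup by p, as long as
    it is not 1, while the number of solutions of x^k = 1 never changes. So the
    exponent of F_i(G)' separates the terms of the string and is 1 for the last
    one, and (c) holds because a finite abelian group is determined by the
    number of solutions of x^k = 1 for each k: split off a cyclic factor of
    maximal order, whose contribution to these numbers can be cancelled. *)

Set Implicit Arguments.
Unset Strict Implicit.
Unset Printing Implicit Defensive.

Local Open Scope group_scope.

(** * Counting the solutions of x^k = 1, and finite abelian groups *)

Lemma card_Ldiv_eq (gT : finGroupType) (A : {group gT}) k :
  (#|'Ldiv_k(A)| == #|A|) = (exponent A %| k).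
Proof.
rewrite -sub_Ldiv (subset_leqif_cards (subsetIl A 'Ldiv_k())).
by rewrite eqEsubset subsetIl.
Qed.

(** As (x * y)^k = x^k * y^k and [A] meets [B] trivially, x * y is a solution exactly when both
    factors are. *)
Lemma card_Ldiv_dprod (gT : finGroupType) (A B G : {group gT}) k :
  A \x B = G -> #|'Ldiv_k(G)| = (#|'Ldiv_k(A)| * #|'Ldiv_k(B)|)%N.
Proof.
case/dprodP=> _ defG cAB tiAB; rewrite -cardsX.
have cm x y : x \in A -> y \in B -> commute x y.
  by move=> Ax By; apply/esym/(centsP cAB).
have -> : 'Ldiv_k(G) = [set u.1 * u.2 | u in setX 'Ldiv_k(A) 'Ldiv_k(B)].
  apply/setP=> z; apply/LdivP/imsetP => [[] | [[x y]]].
    rewrite -defG => /mulsgP[x y Ax By ->] zk; exists (x, y) => //.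
    have /eqP := zk; rewrite expgMn; last exact: cm.
    rewrite -eq_invg_mul => /eqP xyk.
    have /set1P xk : x ^+ k \in [1].
      by rewrite -tiAB inE groupX //= -groupV xyk groupX.
    by apply/setXP; split; apply/LdivP; rewrite // -xyk xk invg1.
  case/setXP=> /LdivP[Ax xk] /LdivP[By yk] -> /=; split.
    by rewrite -defG mem_mulg.
  by rewrite expgMn ?xk ?yk ?mulg1 //; apply: cm.
rewrite card_in_imset // => -[x y] [x' y'] /setXP[/LdivP[Ax _] /LdivP[By _]].
case/setXP=> /LdivP[Ax' _] /LdivP[By' _] /= e.
have e1 : x'^-1 * x = y' * y^-1.
  by apply: (mulgI x'); rewrite mulKVg mulgA -e mulgK.
have /set1P e2 : x'^-1 * x \in [1].
  by rewrite -tiAB inE groupM ?groupV // e1 groupM ?groupV.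
congr (_, _); first by apply: (mulgI x'^-1); rewrite e2 mulVg.
by apply: (mulIg y^-1); rewrite mulgV -e1 e2.
Qed.

(** The exponent can be read off from the solution counts, so the cyclic factors split off from two
    groups with equal counts are isomorphic. *)
Lemma abelian_split_exponent (gT : finGroupType) (A : {group gT}) :
  abelian A ->
  exists x, exists K : {group gT}, #[x] = exponent A /\ <[x]> \x K = A.
Proof.
move=> cAA; have [x Ax ox] := exponent_witness (abelian_nil cAA).
have /splitsP[K /complP[tiK defA]] := abelian_splits Ax (esym ox) cAA.
exists x, K; split=> //.
rewrite dprodE // (sub_abelian_cent2 cAA) ?cycle_subG //.
by rewrite -defA mulG_subr.
Qed.

Lemma abelian_card_Ldiv_isog (gT rT : finGroupType)
    (A : {group gT}) (B : {group rT}) :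
    abelian A -> abelian B -> (forall k, #|'Ldiv_k(A)| = #|'Ldiv_k(B)|) ->
  A \isog B.
Proof.
have [m] := ubnP #|A|; elim: m A B => // m IHm A B ltAm cAA cBB eqL.
have eqAB : #|A| = #|B|.
  (* Both exponents divide this product, so all elements of both groups are solutions for it. *)
  have /eqP <- : #|'Ldiv_(exponent A * exponent B)(A)| == #|A|.
    by rewrite card_Ldiv_eq dvdn_mulr.
  by rewrite eqL; apply/eqP; rewrite card_Ldiv_eq dvdn_mull.
have eqe : exponent A = exponent B.
  (* Each exponent divides the other, since divisibility of k by the exponent means that the count
     for k is the full order. *)
  apply/eqP; rewrite eqn_dvd -card_Ldiv_eq eqL eqAB card_Ldiv_eq dvdnn.
  by rewrite -card_Ldiv_eq -eqL -eqAB card_Ldiv_eq dvdnn.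
have [A1 | ntA] := eqVneq (A : {set gT}) 1.
  apply: trivial_isog; first by rewrite A1.
  by apply: card1_trivg; rewrite -eqAB A1 cards1.
have [x [K [ox defA]]] := abelian_split_exponent cAA.
have [y [L [oy defB]]] := abelian_split_exponent cBB.
have isoxy : <[x]> \isog <[y]>.
  by rewrite isog_cyclic_card ?cycle_cyclic // -!orderE oy ox eqe eqxx.
apply: (isog_dprod defA defB isoxy); apply: IHm.
- have := dprod_card defA; rewrite -orderE ox => oA.
  rewrite -ltnS (leq_trans _ ltAm) // ltnS -oA ltn_Pmull ?cardG_gt0 //.
  rewrite ltn_neqAle exponent_gt0 andbT eq_sym; apply: contraNneq ntA => e1.
  by rewrite trivg_exponent e1.
- case/dprodP: defA => _ defA _ _.
  by apply: abelianS cAA; rewrite -defA mulG_subr.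
- case/dprodP: defB => _ defB _ _.
  by apply: abelianS cBB; rewrite -defB mulG_subr.
move=> k; have /eqP := eqL k.
rewrite (card_Ldiv_dprod k defA) (card_Ldiv_dprod k defB).
have -> : #|'Ldiv_k(<[x]>)| = #|'Ldiv_k(<[y]>)|.
  by case/isogP: isoxy => f injf <-; rewrite -injm_Ldiv // card_injm ?subsetIl.
(* The common count of the cyclic factors can be cancelled: it is positive because 1 is a
   solution. *)
rewrite eqn_pmul2l => [/eqP//|].
by apply/card_gt0P; exists 1; rewrite !inE group1 expg1n eqxx.
Qed.

(** * Powers and commutators in twisted groups *)

Lemma twist_expg n (G : nil2GroupType) (x : G) k :
  (x : twist n G) ^+ k = (x ^+ k : G).
Proof.
elim: k => // k IHk.
have step : (x : twist n G) ^+ k.+1 = twist_mul n x ((x : twist n G) ^+ k).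
  exact: expgS.
rewrite step IHk /twist_mul (_ : [~ x, x ^+ k] = 1) ?expg1n ?mul1g ?expgS //.
exact/eqP/commgP/commuteX.
Qed.

(** Put c = [x, y], which is central. The twisted products of x, y and of y, x are c^n x y = c^(n+1)
    y x and c^(-n) y x, so they differ by the factor c^(2n+1). Twisted and ordinary products agree
    when one factor is central. *)
Lemma twist_commg n (G : nil2GroupType) (x y : G) :
  [~ x : twist n G, y : twist n G] = ([~ x, y] ^+ n.*2.+1 : G).
Proof.
have cC k (u v z : G) : commute ([~ u, v] ^+ k) z.
  by apply/commute_sym/commuteX/commute_sym/commg_central.
apply: (@mulgI (twist n G) ((y : twist n G) * (x : twist n G))).
transitivity ((x : twist n G) * (y : twist n G)); first exact/esym/commgC.
change (twist_mul n x y = twist_mul n (twist_mul n y x) ([~ x, y] ^+ n.*2.+1)).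
rewrite [RHS]/twist_mul.
have -> : [~ twist_mul n y x, [~ x, y] ^+ n.*2.+1] = 1.
  by apply/eqP/commgP/commute_sym.
rewrite expg1n mul1g /twist_mul -(invg_comm x y) expgVn.
rewrite -addnn -addSn expgD [_ ^+ n.+1 * _]cC.
rewrite -!mulgA; apply: (@mulgI _ ([~ x, y] ^+ n)); rewrite mulKVg.
rewrite [x * y]commgC expgSr; set c := [~ x, y]; have {}cC k z := cC k x y z.
rewrite -/c in cC *; rewrite !mulgA -expgD -[y * x * _ * _]mulgA -expgD.
by rewrite -(cC _ (y * x)) !mulgA.
Qed.

(** A condition on single commutators passes through twists, products and isomorphisms without any
    computation of derived subgroups. *)
Definition comm_exp (G : finGroupType) k := forall x y : G, [~ x, y] ^+ k = 1.

Lemma card_Ldiv_iter_twist n i (G : nil2GroupType) k :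
  #|'Ldiv_k([set: iter_twist n i G])| = #|'Ldiv_k([set: G])|.
Proof.
elim: i => // i <-.
change (#|'Ldiv_k([set: twist n (iter_twist n i G)])|
  = #|'Ldiv_k([set: iter_twist n i G])|).
move: (iter_twist n i G) => K.
by apply: eq_card => x; rewrite !inE twist_expg.
Qed.

Lemma comm_exp_twist n (G : nil2GroupType) k :
  comm_exp (twist n G) k <-> comm_exp G (n.*2.+1 * k).
Proof.
by split=> cG x y; have := cG x y; rewrite twist_commg twist_expg expgM.
Qed.

Lemma comm_exp_iter_twist n i (G : nil2GroupType) k :
  comm_exp (iter_twist n i G) k <-> comm_exp G (n.*2.+1 ^ i * k).
Proof.
elim: i k => [|i IHi] k; first by rewrite mul1n.
by rewrite expnSr -mulnA; apply: iff_trans (IHi _); apply: comm_exp_twist.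
Qed.

(** The derived subgroup lies in the center, hence is abelian, so its exponent can be tested on the
    generating commutators. *)
Lemma comm_exp_exponent (G : nil2GroupType) k :
  comm_exp G k <-> exponent [set: G]^`(1) %| k.
Proof.
rewrite abelian_exponent_gen; last first.
  apply: abelianS (center_abelian [set: G]).
  by apply: subset_trans (der1_sub_center (s := G)); apply: subset_gen.
split=> [cG | /exponentP cG x y]; last first.
  by apply: cG; apply: imset2_f; rewrite inE.
by apply/exponentP=> _ /imset2P[x y _ _ ->].
Qed.

Lemma exponent_der1_subg (G : nil2GroupType) (P : {group G}) :
  exponent [set: subg_of P]^`(1) = exponent P^`(1).
Proof.
rewrite -[in RHS](im_sgval P) -morphim_der ?subsetT //.
by rewrite exponent_injm ?injm_sgval ?subsetT.
Qed.

(** * Decomposition into Sylow subgroups *)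

(** A nilpotent group is the direct product of its pi-core and its pi'-core, and taking the
    pi-constituent is the projection to the first factor. *)
Lemma constt_nilM (gT : finGroupType) (G : {group gT}) pi :
  nilpotent G -> {in G &, {morph (fun x : gT => x.`_pi) : x y / x * y}}.
Proof.
move=> nilG x y Gx Gy.
have sub rho z : z \in G -> z.`_rho \in 'O_rho(G).
  move=> Gz.
  rewrite (mem_normal_Hall (nilpotent_pcore_Hall _ nilG)) ?pcore_normal //.
    exact: p_elt_constt.
  exact: groupX.
have /dprodP[_ _ cPP' _] := nilpotent_pcoreC pi nilG.
have c u v : u \in 'O_pi(G) -> v \in 'O_pi^'(G) -> commute u v.
  by move=> Pu Pv; apply/esym/(centsP cPP').
have {1}-> : x * y = (x.`_pi * y.`_pi) * (x.`_pi^' * y.`_pi^').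
  rewrite -{1}(consttC pi x) -{1}(consttC pi y) -!mulgA; congr (_ * _).
  by rewrite !mulgA; congr (_ * _); apply/esym/c; apply: sub.
have [Pxy P'xy] :
    x.`_pi * y.`_pi \in 'O_pi(G) /\ x.`_pi^' * y.`_pi^' \in 'O_pi^'(G).
  by split; rewrite groupM // sub.
rewrite consttM; last exact: c.
rewrite constt_p_elt ?(mem_p_elt (pcore_pgroup _ _) Pxy) //.
by rewrite (constt1P (mem_p_elt (pcore_pgroup _ _) P'xy)) mulg1.
Qed.

Lemma nil2_nilpotent (G : nil2GroupType) : nilpotent [set: G].
Proof.
apply/lcnP; exists 2; apply/commG1P.
exact: subset_trans (der1_sub_center (s := G)) (subsetIr _ _).
Qed.

Lemma prime_at_pi (G : nil2GroupType) (j : 'I_(nprimes G)) :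
  prime_at G j \in primes #|G|.
Proof. exact: mem_nth. Qed.

(** The isomorphism sends x to the family of its p-constituents. It is injective because x is the
    product of its constituents, and surjective because the orders agree. *)
Lemma isog_prod_Sylow (G : nil2GroupType) :
  [set: G] \isog
    [set: {dffun forall j : 'I_(nprimes G), subg_of (Sylow_at G j)}].
Proof.
pose T : finGroupType :=
  {dffun forall j : 'I_(nprimes G), subg_of (Sylow_at G j)}.
pose f (x : G) : T :=
  [ffun j : 'I_(nprimes G) => subg (Sylow_at G j) x.`_(prime_at G j)].
have fP x j : x.`_(prime_at G j) \in Sylow_at G j.
  rewrite (mem_normal_Hall (Sylow_at_Sylow G j)) ?pcore_normal ?inE //.
  exact: p_elt_constt.
have fM : {in [set: G] &, {morph f : x y / x * y}}.
  move=> x y _ _; apply/ffunP=> j; rewrite !ffunE.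
  rewrite (constt_nilM _ (nil2_nilpotent G)) ?inE // -[RHS]sgvalK.
  by congr (subg _ _); rewrite /= !subgK.
have injf : 'injm (Morphism fM).
  apply/subsetP=> x /morphpreP[_ /set1P /ffunP fx1]; apply/set1P.
  rewrite -[x]prod_constt big1 // => p _; apply/constt1P.
  have [Gp|G'p] := boolP (p \in primes #|G|).
    have ltj : index p (primes #|G|) < nprimes G by rewrite index_mem.
    have := fx1 (Ordinal ltj); rewrite !ffunE /= => /(congr1 (@sgval _ _)).
    by rewrite subgK // /prime_at nth_index // => /constt1P.
  (* For a prime not dividing the order of [G], the constituent is trivial. *)
  apply: pnat_dvd (order_dvdG (in_setT x)) _; rewrite cardsT.
  by rewrite p'natEpi ?cardG_gt0 //; rewrite -cardsT cardG_gt0.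
apply/isogP; exists (Morphism fM) => //.
apply/eqP; rewrite eqEcard subsetT card_injm //=.
have -> : [set: T] =
    setXn (fun j : 'I_(nprimes G) => [set: subg_of (Sylow_at G j)]).
  by apply/setP=> x; rewrite inE; apply/esym/setXnP => j; rewrite inE.
rewrite cardsXn [leqRHS]cardsT [leqRHS]prod_prime_decomp; last first.
  by rewrite -cardsT cardG_gt0.
rewrite prime_decompE big_map (big_nth 1%N) big_mkord.
apply: leq_prod => j _ /=.
rewrite -(card_injm (injm_sgval _)) ?subsetT // im_sgval.
by rewrite (card_Hall (Sylow_at_Sylow G j)) p_part cardsT.
Qed.

(** * Direct products and isomorphic groups *)

Section Product.

Variables (I : finType) (gT : I -> finGroupType).
Notation gTn := {dffun forall i, gT i}.

Lemma dffunX (f : gTn) k i : (f ^+ k) i = f i ^+ k.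
Proof.
by elim: k => [|k IHk]; rewrite ?expg0 ?oneg_ffun // !expgS mulg_ffun IHk.
Qed.

Lemma dffunR (f g : gTn) i : [~ f, g] i = [~ f i, g i].
Proof. by rewrite !mulg_ffun !invg_ffun. Qed.

Lemma card_Ldiv_prod k :
  #|'Ldiv_k([set: gTn])| = (\prod_i #|'Ldiv_k([set: gT i])|)%N.
Proof.
rewrite -cardsXn; apply: eq_card => f; apply/LdivP/setXnP => [[_ fk] i | fk].
  by apply/LdivP; rewrite -dffunX fk oneg_ffun inE.
split; first by rewrite inE.
by apply/ffunP=> i; rewrite dffunX oneg_ffun; case/LdivP: (fk i).
Qed.

Lemma comm_exp_prod k : comm_exp gTn k <-> forall i, comm_exp (gT i) k.
Proof.
split=> [cG i x y | cG f g]; last first.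
  by apply/ffunP=> i; rewrite dffunX dffunR cG oneg_ffun.
have := cG (dfung1 x) (dfung1 y) => /ffunP/(_ i).
by rewrite dffunX dffunR !dfung1_id oneg_ffun.
Qed.

End Product.

Lemma comm_exp_isog (G H : finGroupType) k :
  [set: G] \isog [set: H] -> comm_exp H k -> comm_exp G k.
Proof.
case/isogP=> f injf _ cH x y; apply: (injmP injf); rewrite ?inE //.
by rewrite morph1 morphX ?morphR ?inE.
Qed.

Lemma card_Ldiv_isog (G H : finGroupType) k :
  [set: G] \isog [set: H] -> #|'Ldiv_k([set: G])| = #|'Ldiv_k([set: H])|.
Proof.
by case/isogP=> f injf <-; rewrite -injm_Ldiv // card_injm ?subsetIl.
Qed.

Lemma comm_exp_abelian (G : finGroupType) : comm_exp G 1 -> abelian [set: G].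
Proof. by move=> cG; apply/centsP=> x _ y _; apply/commgP/eqP/cG. Qed.

(** * Solution counts and commutators in the terms of the string *)

Lemma card_Ldiv_string (G : nil2GroupType) i k :
  #|'Ldiv_k([set: group_string G i])| = #|'Ldiv_k([set: G])|.
Proof.
case: i => [|i] //.
rewrite (card_Ldiv_isog _ (isog_prod_Sylow G)) !card_Ldiv_prod.
by apply: eq_bigr => j _; apply: card_Ldiv_iter_twist.
Qed.

Lemma order_structure_card_Ldiv (G H : finGroupType) k :
  order_structure G = order_structure H ->
  #|'Ldiv_k([set: G])| = #|'Ldiv_k([set: H])|.
Proof.
have Ldiv_count (K : finGroupType) :
    #|'Ldiv_k([set: K])| = count (fun m => m %| k) (order_structure K).
  rewrite /order_structure (seq.permP (permEl (perm_sort _ _))) count_map.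
  rewrite cardE size_filter.
  by rewrite enumT; apply: eq_count => x /=; rewrite !inE order_dvdn.
by rewrite !Ldiv_count => ->.
Qed.

Lemma leq_string_steps (G : nil2GroupType) i j : string_steps G i j <= texp G j.
Proof. exact: geq_minr. Qed.

(** In the factor at a prime p, each twist divides the exponent p^t of the derived subgroup by p,
    and k must be divisible by what remains at every prime. *)
Lemma comm_exp_string (G : nil2GroupType) i k : odd #|G| ->
  comm_exp (group_string G i) k <->
  forall j : 'I_(nprimes G),
    (prime_at G j ^ (texp G j - string_steps G i j))%N %| k.
Proof.
move=> oddG.
have factorP (j : 'I_(nprimes G)) s : s <= texp G j ->
    comm_exp (iter_twist (prime_at G j).-1./2 s (subg_of (Sylow_at G j))) k <->
    (prime_at G j ^ (texp G j - s))%N %| k.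
  move=> le_s; have := prime_at_pi j; rewrite mem_primes => /and3P[pr_p _ pG].
  (* With n = (p - 1) / 2 and p odd, 2n + 1 = p. *)
  have pE : (prime_at G j).-1./2.*2.+1 = prime_at G j.
    have := dvdn_odd pG oddG; case: (prime_at G j) pr_p => //= p _ /negbTE op.
    by rewrite -[in RHS](odd_double_half p) op.
  apply: iff_trans (comm_exp_iter_twist _ _ _ _) _.
  apply: iff_trans (comm_exp_exponent _ _) _.
  rewrite exponent_der1_subg texpE // pE -{1}(subnKC le_s) expnD.
  by rewrite dvdn_pmul2l // expn_gt0 prime_gt0.
(* An arbitrary step function [s] also covers term 0, which is [G] itself and reaches the untwisted
   product only through an isomorphism. *)
have prodP (s : nat -> nat) : (forall j, s j <= texp G j) ->
    comm_exp {dffun forall j : 'I_(nprimes G),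
       iter_twist (prime_at G j).-1./2 (s j) (subg_of (Sylow_at G j))} k <->
    forall j : 'I_(nprimes G), (prime_at G j ^ (texp G j - s j))%N %| k.
  move=> le_s; apply: iff_trans (comm_exp_prod _ _) _.
  by split=> h j; apply/factorP.
case: i => [|i]; last by apply: prodP => j; apply: geq_minr.
have s0 j : string_steps G 0 j = 0 by rewrite /string_steps sub0n min0n.
have := prodP (fun=> 0) (fun=> leq0n _); set P := comm_exp _ k => P0.
have eP : comm_exp (group_string G 0) k <-> P.
  by split; apply: comm_exp_isog; [rewrite isog_sym|]; apply: isog_prod_Sylow.
by apply: iff_trans eP (iff_trans P0 _); split=> h j; have := h j; rewrite s0.
Qed.

(** * Number of twists at each prime *)

Lemma prime_at_prime (G : nil2GroupType) (j : 'I_(nprimes G)) :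
  prime (prime_at G j).
Proof. by have := prime_at_pi j; rewrite mem_primes => /and3P[]. Qed.

Lemma TsumS (G : nil2GroupType) m : Tsum G m.+1 = (Tsum G m + texp G m)%N.
Proof. exact: big_nat_recr. Qed.

Lemma leq_Tsum (G : nil2GroupType) m n : m <= n -> Tsum G m <= Tsum G n.
Proof.
move=> /subnKC <-; elim: (n - m) => [|d IHd]; rewrite ?addn0 // addnS TsumS.
exact: leq_trans IHd (leq_addr _ _).
Qed.

Lemma string_steps_last (G : nil2GroupType) (j : 'I_(nprimes G)) :
  string_steps G (string_last G) j = texp G j.
Proof.
apply/minn_idPr; rewrite leq_subRL; last exact/leq_Tsum/ltnW.
by rewrite -TsumS; apply: leq_Tsum.
Qed.

Lemma comm_exp_string_last (G : nil2GroupType) :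
  odd #|G| -> comm_exp (group_string G (string_last G)) 1.
Proof.
by move=> oddG; apply/comm_exp_string => // j; rewrite string_steps_last subnn.
Qed.

(** The prime sought is the one being twisted just after term i: its index j satisfies Tsum j <= i <
    Tsum (j+1), so its twists are not exhausted at i and at least one more has been made at i'. *)
Lemma string_steps_ltn (G : nil2GroupType) i i' :
    i < i' -> i' <= string_last G ->
  exists j : 'I_(nprimes G), string_steps G i j < string_steps G i' j.
Proof.
move=> lt_ii' le_i'.
have [m lt_im le_m] : exists2 m, i < Tsum G m & m <= nprimes G.
  by exists (nprimes G) => //; apply: leq_trans le_i'.
elim: m le_m lt_im => [|m IHm] ltm; first by rewrite /Tsum big_geq.
have [lt_im _ | le_mi] := ltnP i (Tsum G m); first exact: IHm (ltnW ltm) lt_im.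
rewrite TsumS => lt_im; exists (Ordinal ltm).
rewrite /string_steps /= leq_min gtn_min ltn_sub2r ?(leq_ltn_trans le_mi) //=.
by rewrite gtn_min ltn_subLR // lt_im.
Qed.

Local Close Scope group_scope.

Theorem theorem1p3 (r : nat) (r_gt1 : 1 < r) (r_odd : odd r) :
  [/\ (* (a) *)
      forall G : nil2GroupType, #|G| = r ->
        forall i i' : nat, i < i' -> i' <= string_last G ->
          ~ ([set: group_string G i] \isog [set: group_string G i'])%g,
      (* (b) *)
      forall G : nil2GroupType, #|G| = r ->
        abelian [set: group_string G (string_last G)]
    & (* (c) *)
      forall G H : nil2GroupType, #|G| = r -> #|H| = r ->
        order_structure G = order_structure H ->
        ([set: group_string G (string_last G)]
           \isog [set: group_string H (string_last H)])%g].
Proof.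
have oddE (G : nil2GroupType) : #|G| = r -> odd #|G| by move->.
have abel_last (G : nil2GroupType) :
    #|G| = r -> abelian [set: group_string G (string_last G)].
  by move=> /oddE oddG; apply/comm_exp_abelian/comm_exp_string_last.
split=> // [G /oddE oddG i i' lt_ii' le_i' isoF | G H oG oH eqGH].
  (* This is the exponent of the derived subgroup of term i'. An isomorphism would make k kill the
     commutators of term i too, but at the prime j a higher power is still needed there. *)
  pose k := (\prod_(j < nprimes G)
    prime_at G j ^ (texp G j - string_steps G i' j))%N.
  have [j lt_j] := string_steps_ltn lt_ii' le_i'.
  have : comm_exp (group_string G i') k.
    by apply/comm_exp_string => // l; rewrite /k (bigD1 l) //= dvdn_mulr.
  move=> /(comm_exp_isog isoF)/comm_exp_string-/(_ oddG j).
  (* The factors of k at the other primes are coprime to the prime at j, so only the powers of that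
     prime are compared. *)
  rewrite /k (bigD1 j) //= Gauss_dvdl; last first.
    apply: (big_ind (coprime _)) => [|m n|l ne_lj]; rewrite ?coprimen1 //.
      by rewrite coprimeMr => ->.
    apply/coprimeXl/coprimeXr.
    rewrite prime_coprime ?dvdn_prime2 ?prime_at_prime //.
    by rewrite nth_uniq ?primes_uniq // eq_sym.
  rewrite dvdn_Pexp2l ?prime_gt1 ?prime_at_prime //.
  by rewrite leq_sub2lE ?leq_string_steps // leqNgt lt_j.
(* Both last terms are abelian and have the solution counts of [G] and [H], which the order
   structure determines. *)
apply: abelian_card_Ldiv_isog; rewrite ?abel_last // => k.
by rewrite !card_Ldiv_string; apply: order_structure_card_Ldiv.
Qed.
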